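(* Let $\Sigma=(X,X_{fr},\widetilde B)$ and $\Sigma'$ be seeds. Then $\mathcal A(\Sigma')$ is a rooted cluster subalgebra of $\mathcal A(\Sigma)$ if and only if there exists a mixing-type sub-seed $\Sigma_{I_0,I_1}$ of $\Sigma$ (with $I_0\subseteq X$, $I_1\subseteq\widetilde X$, $I_0\cap I_1=\emptyset$) such that $\Sigma'\cong\Sigma_{I_0,I_1}$ (isomorphism of seeds) and $b_{xy}=0$ for all $x\in X\setminus(I_0\cup I_1)$ and $y\in I_1$.
   Context: **Seeds and cluster algebras.** A seed $\Sigma=(X,X_{fr},\widetilde B)$ consists of disjoint finite sets $X=\{x_1,\dots,x_n\}$ (the cluster; its elements are exchangeable variables; $X=\emptyset$ is allowed) and $X_{fr}=\{x_{n+1},\dots,x_{n+m}\}$ (frozen variables) such that the extended cluster $\widetilde X=X\cup X_{fr}$ is algebraically independent over $\mathbb Q$ and generates the field $\mathbb F(\Sigma)=\mathbb Q(\widetilde X)$, together with an integer matrix $\widetilde B=(b_{xy})_{x\in X,y\in\widetilde X}$ whose principal part $B=(b_{xy})_{x,y\in X}$ is totally sign-skew-symmetric: every matrix obtained from it by finitely many mutations is sign-skew-symmetric (for all $x,y$, either $b_{xy}=b_{yx}=0$ or $b_{xy}b_{yx}<0$). For $x\in X$ the mutation $\mu_x(\Sigma)$ replaces $x$ by $\mu_x(x)=x^{-1}\bigl(\prod_{b_{xt}>0}t^{b_{xt}}+\prod_{b_{xt}<0}t^{-b_{xt}}\bigr)$ ($t\in\widetilde X$), fixes the other variables ($\mu_x(y)=y$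 for $y\ne x$), and replaces $\widetilde B$ by the matrix with entries $-b_{yz}$ if $y=x$ or $z=x$, and $b_{yz}+\frac{|b_{yx}|b_{xz}+b_{yx}|b_{xz}|}{2}$ otherwise (relabelling $x$ as $\mu_x(x)$). $\mathcal A(\Sigma)$ is the $\mathbb Z[X_{fr}]$-subalgebra of $\mathbb F(\Sigma)$ generated by all cluster variables in all seeds obtained from $\Sigma$ by iterated mutations; together with its initial seed $\Sigma$ it is called a rooted cluster algebra. **Rooted cluster morphisms.** A sequence $(y_1,\dots,y_l)$ is $\Sigma$-admissible if $y_1$ is exchangeable in $\Sigma$ and $y_i$ is exchangeable in $\mu_{y_{i-1}}\cdots\mu_{y_1}(\Sigma)$ for $i\ge2$; it is $(f,\Sigma,\Sigma')$-biadmissible if moreover $(f(y_1),\dots,f(y_l))$ is $\Sigma'$-admissible. A rooted cluster morphism $f:\mathcal A(\Sigma)\to\mathcal A(\Sigma')$ is a unital ring homomorphism with (CM1) $f(\widetilde X)\subseteq\widetilde X'\sqcup\mathbb Z$; (CM2) $f(X)\subseteq X'\sqcup\mathbb Z$; (CM3) $f(\mu_{y_s}\cdots\mu_{y_1}(y))=\mu_{f(y_s)}\cdots\mu_{f(y_1)}(f(y))$ for every $(f,\Sigma,\Sigma')$-biadmissible sequence $(y_1,\dots,y_s)$ and every $y\in\widetilde X$ (mutations fix integers). $\mathcal A(\Sigma')$ is a rooted cluster subalgebra of $\mathcal A(\Sigma)$ if there is an injective rooted cluster morphism $\mathcal A(\Sigma')\to\mathcal A(\Sigma)$. **Seed homomorphisms.**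 Pairs $(x,y),(z,w)$ with $x,z\in X$, $y,w\in\widetilde X$ are adjacent if $b_{xz}\neq0$ or $x=z$. A seed homomorphism $f:\Sigma\to\Sigma'$ is a map $f:\widetilde X\to\widetilde X'$ with $f(X)\subseteq X'$ such that for all adjacent pairs $(x,y),(z,w)$: $(b'_{f(x)f(y)}b_{xy})(b'_{f(z)f(w)}b_{zw})\ge0$ and $|b'_{f(x)f(y)}|\ge|b_{xy}|$. It is a seed isomorphism (written $\Sigma\cong\Sigma'$) if it induces bijections $X\to X'$ and $\widetilde X\to\widetilde X'$ and $|b_{xy}|=|b'_{f(x)f(y)}|$ for all $x\in X,y\in\widetilde X$. **Mixing-type sub-seeds.** For $I_0\subseteq X$, $I_1\subseteq\widetilde X$ with $I_0\cap I_1=\emptyset$, the mixing-type sub-seed is $\Sigma_{I_0,I_1}=(X\setminus(I_0\cup I_1),\,(X_{fr}\cup I_0)\setminus I_1,\,\widetilde B')$, where $\widetilde B'$ is the restriction of $\widetilde B$ to rows $X\setminus(I_0\cup I_1)$ and columns $\widetilde X\setminus I_1$. *)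

(* Defs.v *)
From HB Require Import structures.
From mathcomp Require Import all_boot all_order all_algebra.
From mathcomp Require Import boolp.
From mathcomp Require Import mpoly.

Set Implicit Arguments.
Unset Strict Implicit.
Unset Printing Implicit Defensive.

Import Order.TTheory GRing.Theory Num.Theory.
Local Open Scope ring_scope.

Section GeneratedSubfield.
Variables (K : fieldType) (T : finType) (v : T -> K).

Definition subfield_pred : {pred K} :=
  fun z => `[< forall P : {pred K}, divring_closed P ->
                 (forall t, v t \in P) -> z \in P >].

Fact subfield_pred_closed : divring_closed subfield_pred.
Proof.
split=> [|x y /asboolP hx /asboolP hy|x y /asboolP hx /asboolP hy];
  apply/asboolP => P hP hv; case: (hP) => h1 hB hM.
- exact: h1.
- by apply: hB; [exact: hx | exact: hy].
- by apply: hM; [exact: hx | exact: hy].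
Qed.

HB.instance Definition _ :=
  GRing.isDivringClosed.Build K subfield_pred subfield_pred_closed.

(* The prime field of K lies in every division subring, so in characteristic 0
   this is Q(v t : t in T). *)
Record subfield : Type :=
  Subfield { subfield_val : K; _ : subfield_val \in subfield_pred }.

HB.instance Definition _ := [isSub for subfield_val].
HB.instance Definition _ := [Choice of subfield by <:].
HB.instance Definition _ := [SubChoice_isSubComUnitRing of subfield by <:].
HB.instance Definition _ :=
  [SubComUnitRing_isSubIntegralDomain of subfield by <:].
HB.instance Definition _ := [SubIntegralDomain_isSubField of subfield by <:].

Fact subfield_gen (t : T) : v t \in subfield_pred.
Proof. by apply/asboolP => P _; apply. Qed.

Definition subfield_of_gen (t : T) : subfield := Subfield (subfield_gen t).

End GeneratedSubfield.

(* The finite type T labels the extended cluster, so that the relabelling of x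
   as mu_x(x) under mutation is implicit: a label keeps its name while its
   variable changes. Labels outside [exch] are the frozen ones. Only the rows
   of [bmat] with label in [exch] belong to the matrix; the other rows are junk
   and never consulted. *)
Record preseed (K : fieldType) (T : finType) := Preseed {
  exch : {set T};
  cvar : T -> K;
  bmat : T -> T -> int
}.

Section MatrixMutation.
Variable T : finType.
Implicit Types (b : T -> T -> int) (X : {set T}).

(* The division by 2 is exact. *)
Definition mutate_mx b (x : T) : T -> T -> int := fun y z =>
  if (y == x) || (z == x) then - b y z
  else b y z + ((`|b y x| * b x z + b y x * `|b x z|) %/ 2)%Z.

Definition sign_skew_symmetric X b : Prop :=
  forall x y, x \in X -> y \in X ->
    (b x y = 0 /\ b y x = 0) \/ b x y * b y x < 0.

Definition totally_sign_skew_symmetric X b : Prop :=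
  forall s : seq T, all (fun x => x \in X) s ->
    sign_skew_symmetric X (foldl mutate_mx b s).

End MatrixMutation.

(* When this holds K has characteristic 0, by the case of constant p. *)
Definition alg_independent (K : fieldType) (T : finType) (v : T -> K) : Prop :=
  forall p : {mpoly rat[#|T|]},
    mmap ratr (fun i => v (enum_val i)) p = 0 -> p = 0.

Record is_seed (K : fieldType) (T : finType) (S : preseed K T) : Prop := {
  seed_independent : alg_independent (cvar S);
  seed_generates : forall z : K, z \in subfield_pred (cvar S);
  seed_totally_sss : totally_sign_skew_symmetric (exch S) (bmat S)
}.

Section Mutation.
Variables (K : fieldType) (T : finType).
Implicit Type S : preseed K T.

Definition exchange S (x : T) : K :=
  (cvar S x)^-1 * (\prod_(t | 0 < bmat S x t) cvar S t ^ bmat S x t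
                   + \prod_(t | bmat S x t < 0) cvar S t ^ (- bmat S x t)).

Definition mutate S (x : T) : preseed K T :=
  Preseed (exch S)
          (fun y => if y == x then exchange S x else cvar S y)
          (mutate_mx (bmat S) x).

(* Mutation in the direction of an exchangeable variable given as an element of
   the field. In a seed, and in every seed mutation equivalent to it, the
   variables are pairwise distinct, so the label is unique. *)
Definition label_of S (y : K) : option T := [pick x in exch S | cvar S x == y].

Definition exchangeable S (y : K) : bool := isSome (label_of S y).

Definition mutate_at S (y : K) : preseed K T :=
  if label_of S y is Some x then mutate S x else S.

(* The map mu_y; it fixes everything except y, in particular integers. *)
Definition mutate_elt S (y a : K) : K :=
  if label_of S y is Some x then (if a == y then exchange S x else a) else a.

Fixpoint admissible S (ys : seq K) : bool :=
  if ys is y :: ys' then exchangeable S y && admissible (mutate_at S y) ys'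
  else true.

(* mu_{y_l} ... mu_{y_1}(a) for ys = [:: y_1; ...; y_l] *)
Fixpoint mutate_elt_seq S (ys : seq K) (a : K) : K :=
  if ys is y :: ys' then mutate_elt_seq (mutate_at S y) ys' (mutate_elt S y a)
  else a.

End Mutation.

Section ClusterAlgebra.
Variables (K : fieldType) (T : finType) (S : preseed K T).

Definition cluster_alg_pred : {pred K} :=
  fun a => `[< forall P : {pred K}, subring_closed P ->
    (forall x, x \notin exch S -> cvar S x \in P) ->
    (forall s x, all (fun z => z \in exch S) s -> x \in exch S ->
       cvar (foldl (@mutate K T) S s) x \in P) ->
    a \in P >].

Fact cluster_alg_pred_closed : subring_closed cluster_alg_pred.
Proof.
split=> [|x y /asboolP hx /asboolP hy|x y /asboolP hx /asboolP hy];
  apply/asboolP => P hP hf hc; case: (hP) => h1 hB hM.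
- exact: h1.
- by apply: hB; [exact: hx | exact: hy].
- by apply: hM; [exact: hx | exact: hy].
Qed.

HB.instance Definition _ :=
  GRing.isSubringClosed.Build K cluster_alg_pred cluster_alg_pred_closed.

Record cluster_alg : Type :=
  ClusterAlg { cluster_alg_val : K; _ : cluster_alg_val \in cluster_alg_pred }.

HB.instance Definition _ := [isSub for cluster_alg_val].
HB.instance Definition _ := [Choice of cluster_alg by <:].
HB.instance Definition _ := [SubChoice_isSubComNzRing of cluster_alg by <:].

Definition in_cluster (a : cluster_alg) : Prop :=
  exists2 x, x \in exch S & val a = cvar S x.

Definition in_extended_cluster (a : cluster_alg) : Prop :=
  exists x, val a = cvar S x.

Definition is_integer (a : cluster_alg) : Prop := exists k : int, a = k%:~R.

End ClusterAlgebra.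

Section RootedClusterMorphism.
Variables (K K' : fieldType) (T T' : finType).
Variables (S : preseed K T) (S' : preseed K' T').

Definition biadmissible (f : cluster_alg S -> cluster_alg S')
    (ys : seq (cluster_alg S)) : Prop :=
  admissible S (map val ys) /\ admissible S' [seq val (f y) | y <- ys].

(* In CM3, b is mu_{y_s} ... mu_{y_1}(a) seen as an element of the cluster
   algebra, to which it always belongs. *)
Record rooted_cluster_morphism
    (f : {rmorphism cluster_alg S -> cluster_alg S'}) : Prop := {
  rcm_CM1 : forall a, in_extended_cluster a ->
    in_extended_cluster (f a) \/ is_integer (f a);
  rcm_CM2 : forall a, in_cluster a -> in_cluster (f a) \/ is_integer (f a);
  rcm_CM3 : forall ys a b, biadmissible f ys -> in_extended_cluster a ->
    val b = mutate_elt_seq S (map val ys) (val a) ->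
    val (f b) = mutate_elt_seq S' [seq val (f y) | y <- ys] (val (f a))
}.

End RootedClusterMorphism.

Definition rooted_cluster_subalgebra (K' K : fieldType) (T' T : finType)
    (S' : preseed K' T') (S : preseed K T) : Prop :=
  exists f : {rmorphism cluster_alg S' -> cluster_alg S},
    rooted_cluster_morphism f /\ injective f.

Section SeedHomomorphism.
Variables (K K' : fieldType) (T T' : finType).
Variables (S : preseed K T) (S' : preseed K' T').

Definition adjacent (p q : T * T) : bool :=
  (bmat S p.1 q.1 != 0) || (p.1 == q.1).

(* Maps between extended clusters are given on labels. *)
Record seed_homomorphism (g : T -> T') : Prop := {
  shom_exch : forall x, x \in exch S -> g x \in exch S';
  shom_adjacent : forall x y z w, x \in exch S -> z \in exch S ->
    adjacent (x, y) (z, w) ->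
    0 <= (bmat S' (g x) (g y) * bmat S x y) * (bmat S' (g z) (g w) * bmat S z w)
    /\ `|bmat S x y| <= `|bmat S' (g x) (g y)|
}.

Record seed_isomorphism (g : T -> T') : Prop := {
  siso_hom : seed_homomorphism g;
  siso_exch : g @: exch S = exch S';
  siso_bij : bijective g;
  siso_bmat : forall x y, x \in exch S ->
    `|bmat S x y| = `|bmat S' (g x) (g y)|
}.

Definition seed_isomorphic : Prop := exists g, seed_isomorphism g.

End SeedHomomorphism.

Section MixingSubseed.
Variables (K : fieldType) (T : finType) (S : preseed K T) (I0 I1 : {set T}).

Let T1 : finType := {t : T | t \notin I1}.
Let v1 : T1 -> K := fun t => cvar S (val t).

(* Its field is the subfield of K generated by the remaining variables; the
   remaining labels outside [exch] are (X_fr :|: I0) :\: I1. *)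
Definition mixing_subseed : preseed (subfield v1) T1 :=
  Preseed [set t : T1 | val t \in exch S :\: (I0 :|: I1)]
          (subfield_of_gen v1)
          (fun x y => bmat S (val x) (val y)).

End MixingSubseed.

(* Main.v *)
Require Import Defs.
From HB Require Import structures.
From mathcomp Require Import all_boot all_order all_algebra.
From mathcomp Require Import boolp mpoly ring.

(* An injective rooted cluster morphism sends no variable to an integer, so it is
   given by an injection g of labels. Its compatibility with the mutation at x says
   that it carries the two monomials of the exchange relation at x to those of the
   exchange relation at g x; as the variables are algebraically independent, row
   g x vanishes off the image of g and is, up to one sign, row x. Sign skew
   symmetry forces the signs to agree at adjacent x and z.

   Conversely such an injection g, with a sign for each row that is constant on
   connected components, persists under mutation, so that the field embedding
   induced by g maps each cluster variable to the corresponding one. Elements of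
   the field determine labels because the variables of a mutated seed are
   distinct: they take arbitrary positive values at suitable points. *)

Set Implicit Arguments.
Unset Strict Implicit.
Unset Printing Implicit Defensive.
Import Order.TTheory GRing.Theory Num.Theory.
Local Open Scope ring_scope.

(** * Integer polynomials and algebraic independence *)

Notation eval_at w := (mmap (intmul 1) (fun i => w (enum_val i))).

Lemma rmorph_mmap_int (R R' : comNzRingType) (phi : {rmorphism R -> R'}) n
    (w : 'I_n -> R) (p : {mpoly int[n]}) :
  phi (mmap (intmul 1) w p) = mmap (intmul 1) (fun i => phi (w i)) p.
Proof.
rewrite /mmap rmorph_sum; apply: eq_bigr => m _.
rewrite rmorphM rmorph_int /mmap1 rmorph_prod; congr (_ * _).
by apply: eq_bigr => i _; rewrite rmorphXn.
Qed.

Lemma mmap_int_X n (p : {mpoly int[n]}) :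
  mmap (intmul 1) (fun i => 'X_i : {mpoly int[n]}) p = p.
Proof.
rewrite [RHS]mpolyE /mmap; apply: eq_bigr => m _.
by rewrite mmap1_id -mul_mpolyC -[X in X%:MP]intz rmorph_int.
Qed.

(** Integer coefficients make evaluation commute with every ring morphism, as [rmorph_mmap_int]
    shows, including morphisms between polynomial rings. *)
Definition independent_over_int (K : fieldType) (T : finType) (v : T -> K) :=
  forall p : {mpoly int[#|T|]}, eval_at v p = 0 -> p = 0.

Lemma alg_independent_int (K : fieldType) (T : finType) (v : T -> K) :
  alg_independent v -> independent_over_int v.
Proof.
move=> hv p hp; pose q : {mpoly rat[#|T|]} := map_mpoly intr p.
have q0 : q = 0.
  apply: hv; rewrite -hp.
  rewrite /mmap (perm_big _ (msupp_map_mpoly _ (@intr_inj _))) /=.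
  by apply: eq_bigr => m _; rewrite mcoeff_map_mpoly ratr_int.
apply/mpolyP => m; have := congr1 (mcoeff m) q0.
by rewrite mcoeff_map_mpoly !mcoeff0 => /eqP; rewrite intr_eq0 => /eqP.
Qed.

(** Substituting [X (g t)] for the variable [t] has a left inverse: [u] sends [g t] back to the
    variable [t], by injectivity, and kills the labels outside the image. *)
Lemma independent_comp (K : fieldType) (T T' : finType) (v : T -> K)
    (g : T' -> T) :
  injective g -> independent_over_int v -> independent_over_int (v \o g).
Proof.
move=> ginj hv p hp.
pose X s : {mpoly int[#|T|]} := 'X_(enum_rank s).
pose u s : {mpoly int[#|T'|]} :=
  if [pick t | g t == s] is Some t then 'X_(enum_rank t) else 0.
have ug t : u (g t) = 'X_(enum_rank t).
  rewrite /u; case: pickP => [t' /eqP /ginj -> //|/(_ t)].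
  by rewrite eqxx.
have h0 : eval_at (X \o g) p = 0.
  apply: hv; rewrite rmorph_mmap_int -hp.
  rewrite /mmap; apply: eq_bigr => m _; congr (_ * _); apply: mmap1_eq => i /=.
  by rewrite mmapX mmap1U enum_rankK.
have : eval_at u (eval_at (X \o g) p) = p.
  rewrite rmorph_mmap_int -[RHS]mmap_int_X.
  rewrite /mmap; apply: eq_bigr => m _; congr (_ * _); apply: mmap1_eq => i /=.
  by rewrite mmapX mmap1U enum_rankK ug enum_valK.
by rewrite h0 rmorph0.
Qed.

(** * Monomials indexed by labels *)

Definition monomial (R : comNzRingType) (T : finType) (v : T -> R)
  (a : T -> nat) : R := \prod_t v t ^+ a t.

Lemma rmorph_monomial (R R' : comNzRingType) (phi : {rmorphism R -> R'})
    (T : finType) (v : T -> R) a :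
  phi (monomial v a) = monomial (phi \o v) a.
Proof.
by rewrite /monomial rmorph_prod; apply: eq_bigr => t _; rewrite rmorphXn.
Qed.

Lemma eq_monomial (R : comNzRingType) (T : finType) (v w : T -> R) a b :
  v =1 w -> a =1 b -> monomial v a = monomial w b.
Proof. by move=> vw ab; apply: eq_bigr => t _; rewrite vw ab. Qed.

Lemma monomial_comp (R : comNzRingType) (T T' : finType) (v : T -> R)
    (g : T' -> T) a :
  monomial (v \o g) a = monomial v (fun s => \sum_(t | g t == s) a t)%N.
Proof.
rewrite /monomial (partition_big g predT) //=; apply: eq_bigr => s _.
by rewrite -prodrXr; apply: eq_bigr => t /eqP <-.
Qed.

Lemma monomial_codom (R : comNzRingType) (T T' : finType) (v : T -> R)
    (g : T' -> T) a : injective g -> (forall s, s \notin codom g -> a s = 0%N) ->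
  monomial v a = monomial (v \o g) (a \o g).
Proof.
move=> ginj a0; rewrite monomial_comp; apply: eq_monomial => // s.
have [/codomP [t ->]|sg] := boolP (s \in codom g).
  by rewrite (eq_bigl (pred1 t)) ?big_pred1_eq // => t' /=; rewrite inj_eq.
rewrite a0 // big1 // => t /eqP gt; case/negP: sg.
by rewrite -gt codom_f.
Qed.

Lemma eval_at_monomial (R : comNzRingType) (T : finType) (v : T -> R) a :
  eval_at v 'X_[[multinom a (enum_val i) | i < #|T|]] = monomial v a.
Proof.
rewrite mmapX /mmap1 /monomial (reindex (@enum_val T T)) /=; last first.
  exact: onW_bij (enum_val_bij _).
by apply: eq_bigr => i _; rewrite mnmE.
Qed.

Lemma mpolyX_inj n : injective (fun m : 'X_{1.. n} => 'X_[m] : {mpoly int[n]}).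
Proof.
move=> m m' /(congr1 (mcoeff m)); rewrite !mcoeffX eqxx.
by case: eqP.
Qed.

(** By independence the equation holds between polynomials. The coefficient at [M a] is at least 1
    on the left, so [M a] is one of the two monomials on the right; cancelling it identifies the
    other pair. *)
Lemma two_monomials (K : fieldType) (T : finType) (v : T -> K) a b a' b' :
  independent_over_int v ->
  monomial v a + monomial v b = monomial v a' + monomial v b' ->
  (a =1 a' /\ b =1 b') \/ (a =1 b' /\ b =1 a').
Proof.
move=> hv; rewrite -!eval_at_monomial => /eqP; rewrite -!rmorphD -subr_eq0 -rmorphB.
move=> /eqP /hv /eqP; rewrite subr_eq0 => /eqP E.
pose M c := [multinom c (enum_val i) | i < #|T|] : 'X_{1.. #|T|}.
have inj c c' : M c = M c' -> c =1 c'.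
  move=> /mnmP Mc t; have := Mc (enum_rank t).
  by rewrite !mnmE enum_rankK.
have := congr1 (mcoeff (M a)) E; rewrite !mcoeffD !mcoeffX eqxx.
have [aa'|naa'] := eqVneq (M a') (M a).
  rewrite -/(M a') aa' in E; move/addrI/mpolyX_inj : E => E _.
  by left; split; apply: inj.
have [ab'|nab'] := eqVneq (M b') (M a).
  rewrite -/(M b') ab' addrC in E; move/addIr/mpolyX_inj : E => E _.
  by right; split; apply: inj.
by case: (_ == _).
Qed.

(** * Specialization of rational functions of the variables *)

Definition specializes (K L : fieldType) (T : finType) (v : T -> K)
    (w : T -> L) (z : K) (q : L) : Prop :=
  exists p1 p2 : {mpoly int[#|T|]}, [/\ eval_at w p2 != 0, z * eval_at v p2 = eval_at v p1
                  & q * eval_at w p2 = eval_at w p1].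

Section Specialization.
Variables (K L : fieldType) (T : finType) (v : T -> K) (w : T -> L).
Hypothesis v_indep : independent_over_int v.

Lemma eval_at_neq0 (p : {mpoly int[#|T|]}) : eval_at w p != 0 -> eval_at v p != 0.
Proof. by apply: contra => /eqP /v_indep ->; rewrite rmorph0. Qed.

(** Two fractions representing [z] have equal cross products as polynomials, because [v] is
    independent. Their values at [w] then agree, as neither denominator vanishes there. *)
Lemma specializes_fun z q q' :
  specializes v w z q -> specializes v w z q' -> q = q'.
Proof.
move=> [p1 [p2 [p2w zv qw]]] [r1 [r2 [r2w zv' qw']]].
have E : p1 * r2 = r1 * p2 :> {mpoly int[#|T|]}.
  apply/eqP; rewrite -subr_eq0; apply/eqP/v_indep.
  by rewrite rmorphB !rmorphM /= -zv -zv' mulrAC subrr.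
apply: (mulIf p2w); apply: (mulIf r2w).
have := congr1 (eval_at w) E; rewrite !rmorphM /= -qw -qw' => ->.
by rewrite mulrAC.
Qed.

Lemma specializes_var t : specializes v w (v t) (w t).
Proof.
exists 'X_(enum_rank t), 1; rewrite !rmorph1 !mmapX !mmap1U !enum_rankK !mulr1.
by split; rewrite ?oner_eq0.
Qed.

Lemma specializes1 : specializes v w 1 1.
Proof. by exists 1, 1; rewrite !rmorph1 !mulr1; split; rewrite ?oner_eq0. Qed.

Lemma specializesB z q z' q' : specializes v w z q -> specializes v w z' q' ->
  specializes v w (z - z') (q - q').
Proof.
move=> [p1 [p2 [p2w zv qw]]] [r1 [r2 [r2w zv' qw']]].
exists (p1 * r2 - r1 * p2), (p2 * r2).
rewrite !rmorphB !rmorphM /= -zv -zv' -qw -qw' mulf_neq0 //.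
by split => //; ring.
Qed.

Lemma specializesM z q z' q' : specializes v w z q -> specializes v w z' q' ->
  specializes v w (z * z') (q * q').
Proof.
move=> [p1 [p2 [p2w zv qw]]] [r1 [r2 [r2w zv' qw']]].
exists (p1 * r1), (p2 * r2).
rewrite !rmorphM /= -zv -zv' -qw -qw' mulf_neq0 //.
by split => //; ring.
Qed.

Lemma specializes0 : specializes v w 0 0.
Proof.
by rewrite -[X in specializes _ _ X](subrr 1) -(subrr (1 : L));
   apply: specializesB specializes1 specializes1.
Qed.

Lemma specializesD z q z' q' : specializes v w z q -> specializes v w z' q' ->
  specializes v w (z + z') (q + q').
Proof.
move=> hz hz'; rewrite -[z']opprK -[q']opprK -[- z']sub0r -[- q']sub0r.
exact/specializesB/specializesB/hz'/specializes0.
Qed.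

Lemma specializesV z q : specializes v w z q -> q != 0 ->
  specializes v w z^-1 q^-1.
Proof.
move=> [p1 [p2 [p2w zv qw]]] q0.
have p1w : eval_at w p1 != 0 by rewrite -qw mulf_neq0.
have z0 : z != 0.
  by have := eval_at_neq0 p1w; rewrite -zv mulf_eq0 => /norP [].
by exists p2, p1; split; rewrite // -?zv -?qw mulrA mulVf ?mul1r.
Qed.

Lemma specializes_monomial x y (a : T -> nat) :
  (forall t, specializes v w (x t) (y t)) ->
  specializes v w (monomial x a) (monomial y a).
Proof.
move=> xy; apply: big_ind2 => [||t _]; first exact: specializes1.
  by move=> *; apply: specializesM.
elim: (a t) => [|n IHn]; first by rewrite !expr0; apply: specializes1.
by rewrite !exprS; apply: specializesM.
Qed.

(* Without the independence of [w] a denominator could specialize to 0. *)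
Lemma field_morphism : (forall z, z \in subfield_pred v) ->
  independent_over_int w ->
  exists phi : {rmorphism K -> L}, forall t, phi (v t) = w t.
Proof.
move=> v_gen w_indep.
have neq0 z q : specializes v w z q -> z != 0 -> q != 0.
  move=> [p1 [p2 [p2w zv qw]]]; apply: contra => /eqP q0.
  move: qw; rewrite q0 mul0r => /esym /w_indep p10.
  move: zv; rewrite p10 rmorph0 => /eqP; rewrite mulf_eq0.
  by rewrite (negPf (eval_at_neq0 p2w)) orbF.
have total z : exists q, specializes v w z q.
  (* The elements that have a value form a division ring containing every [v t], hence all of
     [K]. *)
  pose P : {pred K} := fun z => `[< exists q, specializes v w z q >].
  suff : z \in P by move/asboolP.
  have /asboolP := v_gen z; apply=> [|t]; last first.
    by apply/asboolP; exists (w t); apply: specializes_var.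
  split=> [|x y /asboolP [a xa] /asboolP [b yb]
           |x y /asboolP [a xa] /asboolP [b yb]]; apply/asboolP.
  - by exists 1; apply: specializes1.
  - by exists (a - b); apply: specializesB.
  (* The inverse of 0 is 0 by convention, so this quotient takes the value 0. *)
  - have [->|y0] := eqVneq y 0.
      by rewrite invr0 mulr0; exists 0; apply: specializes0.
    by exists (a / b); apply/specializesM/specializesV/(neq0 y).
pose phi z := sval (cid (total z)).
have phiP z : specializes v w z (phi z) by rewrite /phi; case: cid.
have phi_eq z q : specializes v w z q -> phi z = q by apply: specializes_fun.
have phiB : zmod_morphism phi.
  by move=> x y; apply/phi_eq/specializesB.
have phiM : monoid_morphism phi.
  split; first exact/phi_eq/specializes1.
  by move=> x y; apply/phi_eq/specializesM.
pose F : {rmorphism K -> L} := HB.pack phi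
  (GRing.isZmodMorphism.Build K L phi phiB)
  (GRing.isMonoidMorphism.Build K L phi phiM).
by exists F => t; apply/phi_eq/specializes_var.
Qed.

End Specialization.

(** * Exchange relations and their symmetries *)

Definition pospart (z : int) : nat := if 0 < z then `|z|%N else 0%N.

Lemma exprz_pospart (K : fieldType) (T : finType) (v : T -> K) (b : T -> int) :
  \prod_(t | 0 < b t) v t ^ b t = monomial v (fun t => pospart (b t)).
Proof.
rewrite big_mkcond; apply: eq_bigr => t _; rewrite /pospart.
by case: ifP => // b0; rewrite exprnP gtz0_abs.
Qed.

(** This is the product of a variable and its mutation. Being free of division, it makes sense in
    the cluster algebra as well as in its field. *)
Definition exchange_sum (R : comNzRingType) (T : finType) (v : T -> R)
    (b : T -> int) : R :=
  monomial v (pospart \o b) + monomial v (fun t => pospart (- b t)).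

Lemma exchangeE (K : fieldType) (T : finType) (S : preseed K T) x :
  exchange S x = (cvar S x)^-1 * exchange_sum (cvar S) (bmat S x).
Proof.
rewrite /exchange /exchange_sum -!exprz_pospart; congr (_ * (_ + _)).
by apply: eq_bigl => t; rewrite oppr_gt0.
Qed.

Lemma eq_exchange_sum (R : comNzRingType) (T : finType) (v w : T -> R) b c :
  v =1 w -> b =1 c -> exchange_sum v b = exchange_sum w c.
Proof.
by move=> vw bc; congr (_ + _); apply: eq_monomial => // t /=; rewrite bc.
Qed.

(** A sign change of the row swaps the two monomials, so an exchange relation determines its row at
    best up to one sign. *)
Lemma exchange_sumN (R : comNzRingType) (T : finType) (v : T -> R) b :
  exchange_sum v (fun t => - b t) = exchange_sum v b.
Proof.
rewrite /exchange_sum addrC; congr (_ + _).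
by apply: eq_monomial => // t; rewrite opprK.
Qed.

Lemma rmorph_exchange_sum (R R' : comNzRingType) (phi : {rmorphism R -> R'})
    (T : finType) (v : T -> R) b :
  phi (exchange_sum v b) = exchange_sum (phi \o v) b.
Proof. by rewrite rmorphD !rmorph_monomial. Qed.

Lemma exchange_sum_codom (R : comNzRingType) (T T' : finType) (v : T -> R)
    (g : T' -> T) b : injective g -> (forall s, s \notin codom g -> b s = 0) ->
  exchange_sum v b = exchange_sum (v \o g) (b \o g).
Proof.
move=> ginj b0; rewrite /exchange_sum.
by rewrite !(monomial_codom _ ginj) // => s /b0 /= ->.
Qed.

(** Applied with a zero diagonal entry: the exchanged variable does not occur in its own exchange
    sum, so the sum is the same before and after the mutation. *)
Lemma exchange_sum_off (R : comNzRingType) (T : finType) (v w : T -> R) b k :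
  b k = 0 -> (forall t, t != k -> v t = w t) ->
  exchange_sum v b = exchange_sum w b.
Proof.
move=> bk vw; congr (_ + _); apply: eq_bigr => t _ /=;
by have [->|/vw ->//] := eqVneq t k; rewrite bk.
Qed.

Lemma exchange_sum_gt0 (R : realFieldType) (T : finType) (u : T -> R) b :
  (forall t, 0 < u t) -> 0 < exchange_sum u b.
Proof. by move=> u0; apply: addr_gt0; apply: prodr_gt0 => t _; apply: exprn_gt0. Qed.

Lemma specializes_exchange_sum (K L : fieldType) (T : finType) (v : T -> K)
    (w : T -> L) (x : T -> K) (y : T -> L) (b : T -> int) :
  (forall t, specializes v w (x t) (y t)) ->
  specializes v w (exchange_sum x b) (exchange_sum y b).
Proof. by move=> xy; apply: specializesD; apply: specializes_monomial. Qed.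

(** * Iterated mutation and sign skew symmetry *)

Lemma exch_foldl (K : fieldType) (T : finType) (S : preseed K T) s :
  exch (foldl (@mutate K T) S s) = exch S.
Proof. by elim: s S => //= x s IHs S; rewrite IHs. Qed.

Lemma bmat_foldl (K : fieldType) (T : finType) (S : preseed K T) s :
  bmat (foldl (@mutate K T) S s) = foldl (@mutate_mx T) (bmat S) s.
Proof. by elim: s S => //= x s IHs S; rewrite IHs. Qed.

Lemma sign_skew_symmetric_diag (T : finType) (X : {set T}) b x :
  sign_skew_symmetric X b -> x \in X -> b x x = 0.
Proof.
move=> sss xX; case: (sss x x xX xX) => [[]//|].
by rewrite -expr2 ltNge sqr_ge0.
Qed.

Lemma sign_skew_symmetric_neq0 (T : finType) (X : {set T}) b x z :
  sign_skew_symmetric X b -> x \in X -> z \in X -> b x z != 0 ->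
  b x z * b z x < 0.
Proof. by move=> sss xX zX; case: (sss x z xX zX) => // [[->]]; rewrite eqxx. Qed.

Lemma seed_sss (K : fieldType) (T : finType) (S : preseed K T) :
  is_seed S -> sign_skew_symmetric (exch S) (bmat S).
Proof. by move=> /seed_totally_sss /(_ [::] isT). Qed.

(** * Positive values and distinctness of the variables of mutated seeds *)

Section Positivity.
Variables (K : fieldType) (T : finType) (S : preseed K T).
Hypothesis S_seed : is_seed S.

(* Solving the exchange relations backwards expresses the initial variables by
   the mutated ones; on positive values no denominator vanishes. *)
Lemma positive_point s (u : T -> rat) : all (fun x => x \in exch S) s ->
  (forall t, 0 < u t) ->
  exists u0 : T -> rat, forall t,
    specializes (cvar S) u0 (cvar (foldl (@mutate K T) S s) t) (u t).
Proof.
elim/last_ind: s u => [|s k IHs] u /=.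
  by move=> _ _; exists u => t; apply: specializes_var.
rewrite all_rcons => /andP [kS sS] u_gt0; rewrite foldl_rcons.
set S1 := foldl _ S s.
have bkk : bmat S1 k k = 0.
  rewrite bmat_foldl; apply: sign_skew_symmetric_diag kS.
  exact: seed_totally_sss S_seed _ sS.
have M_gt0 := exchange_sum_gt0 (bmat S1 k) u_gt0.
(* The values just before the last mutation: the exchange relation at [k] is symmetric in the old
   and the new variable. *)
pose u1 t := if t == k then (u k)^-1 * exchange_sum u (bmat S1 k) else u t.
have [|u0 u0P] := IHs u1 sS.
  by move=> t; rewrite /u1; case: eqP => // _; rewrite mulr_gt0 ?invr_gt0.
exists u0 => t /=; have [->|tk] := eqVneq t k; last first.
  by have := u0P t; rewrite /u1 (negPf tk).
have -> : u k = (u1 k)^-1 * exchange_sum u1 (bmat S1 k).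
  rewrite [X in _ * X](exchange_sum_off (w := u) bkk) => [|t' /negPf tk'].
    by rewrite /u1 eqxx invfM invrK mulfVK // gt_eqF.
  by rewrite /u1 tk'.
rewrite exchangeE; apply: specializesM; last exact: specializes_exchange_sum.
apply: specializesV (u0P k) _; first exact/alg_independent_int/seed_independent.
by rewrite /u1 eqxx gt_eqF // mulr_gt0 ?invr_gt0.
Qed.

(** Some point gives the mutated variables pairwise distinct values. Equal variables would take
    equal values there, since specialization is single-valued. *)
Lemma mutated_cvar_inj s : all (fun x => x \in exch S) s ->
  injective (cvar (foldl (@mutate K T) S s)).
Proof.
(* Ranks start at 0; the successor makes these distinct values positive. *)
move=> sS x y xy; pose u (t : T) : rat := (enum_rank t).+1%:R.
have [|u0 u0P] := positive_point sS (u := u); first by move=> t; apply: ltr0Sn.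
have v_indep := alg_independent_int (seed_independent S_seed).
have := u0P x; rewrite xy => /(specializes_fun v_indep (u0P y)) /eqP.
by rewrite eqr_nat eqSS => /eqP /val_inj /enum_rank_inj.
Qed.

Lemma cvar_inj : injective (cvar S).
Proof. exact: (@mutated_cvar_inj [::]). Qed.

Lemma cvar_not_int t k : cvar S t <> k%:~R.
Proof.
move=> tk; pose p : {mpoly int[#|T|]} := 'X_(enum_rank t) - k%:~R.
have p0 : p = 0.
  apply: (alg_independent_int (seed_independent S_seed)).
  by rewrite rmorphB rmorph_int /= mmapX mmap1U enum_rankK tk subrr.
(* At the point with all coordinates [k + 1] the polynomial takes the value 1, so it is not zero. *)
have := congr1 (eval_at (fun=> k%:~R + 1 : rat)) p0.
rewrite rmorph0 rmorphB rmorph_int /= mmapX mmap1U addrAC subrr add0r.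
by move/eqP; rewrite oner_eq0.
Qed.

End Positivity.

Lemma label_of_cvar (K : fieldType) (T : finType) (S : preseed K T) x :
  injective (cvar S) -> x \in exch S -> label_of S (cvar S x) = Some x.
Proof.
move=> inj xS; rewrite /label_of; case: pickP => [y /andP [_ /eqP /inj -> //]|].
by move=> /(_ x); rewrite xS eqxx.
Qed.

(** * Matrix mutation and signed embeddings of labels *)

Lemma mutation_numerator_even (a b : int) :
  exists c, `|a| * b + a * `|b| = c * 2.
Proof.
case: (ger0P a) => _; case: (ger0P b) => _.
- by exists (a * b); ring.
- by exists 0; ring.
- by exists 0; ring.
- by exists (- (a * b)); ring.
Qed.

(** The numerator is always even, so a witness [c] can replace the integer quotient and the
    computations reduce to ring identities. *)
Lemma mutate_mxE (T : finType) (b : T -> T -> int) x y z c :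
  y != x -> z != x -> `|b y x| * b x z + b y x * `|b x z| = c * 2 ->
  mutate_mx b x y z = b y z + c.
Proof.
by move=> /negPf yx /negPf zx E; rewrite /mutate_mx yx zx E mulzK.
Qed.

(* [e] gives the sign of each exchangeable row; it is constant on the connected
   components of the principal part, which is what mutation preserves. *)
Record sign_embedding (T T' : finType) (X' : {set T'}) (g : T' -> T)
    (e : T' -> bool) (b' : T' -> T' -> int) (b : T -> T -> int) : Prop := {
  semb_row : forall x y, x \in X' -> b (g x) (g y) = (-1) ^+ e x * b' x y;
  semb_off : forall x s, x \in X' -> s \notin codom g -> b (g x) s = 0;
  semb_sign : forall x z, x \in X' -> z \in X' -> b' x z != 0 -> e x = e z
}.

(** The correction to row [x] is nonzero only if [b' x k] is; then [e x = e k], and the correction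
    acquires the sign of row [x]. It vanishes off the image because row [g k] does. A new connection
    from [x] to [z] passes through [k], so the signs agree along it. *)
Lemma sign_embedding_mutate (T T' : finType) (X' : {set T'}) (g : T' -> T)
    (e : T' -> bool) (b' : T' -> T' -> int) (b : T -> T -> int) k :
  injective g -> k \in X' -> sign_embedding X' g e b' b ->
  sign_embedding X' g e (mutate_mx b' k) (mutate_mx b (g k)).
Proof.
move=> ginj kX [row off sgn]; split=> [x y xX|x s xX sg|x z xX zX].
- have [xyk|] := boolP ((x == k) || (y == k)).
    by rewrite /mutate_mx !(inj_eq ginj) xyk row // mulrN.
  rewrite negb_or => /andP [xk yk].
  have [c cP] := mutation_numerator_even (b' x k) (b' k y).
  rewrite (mutate_mxE _ _ cP) // (@mutate_mxE _ _ _ _ _ ((-1) ^+ e x * c));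
    rewrite ?inj_eq //; first by rewrite row // mulrDr.
  rewrite !row // -[RHS]mulrA -cP.
  have [->|xk0] := eqVneq (b' x k) 0; first by rewrite !mulr0 normr0; ring.
  by rewrite -(sgn x k) // !normrM normrX normrN1 expr1n; ring.
- have sgk : s != g k by apply: contraNneq sg => ->; apply: codom_f.
  have [->|xk] := eqVneq x k; first by rewrite /mutate_mx eqxx off ?oppr0.
  rewrite (@mutate_mxE _ _ _ _ _ 0) ?inj_eq //; first by rewrite off.
  by rewrite (off k s) // normr0 !mulr0 mul0r addr0.
- have [xzk|] := boolP ((x == k) || (z == k)).
    by rewrite /mutate_mx xzk oppr_eq0; apply: sgn.
  rewrite negb_or => /andP [xk zk].
  have [xk0|xk0] := eqVneq (b' x k) 0.
    rewrite (@mutate_mxE _ _ _ _ _ 0) ?addr0 //; first exact: sgn.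
    by rewrite xk0 normr0; ring.
  have [kz0|kz0] := eqVneq (b' k z) 0.
    rewrite (@mutate_mxE _ _ _ _ _ 0) ?addr0 //; first exact: sgn.
    by rewrite kz0 normr0; ring.
  by move=> _; rewrite (sgn x k) // (sgn k z).
Qed.

(** * Field morphisms compatible with mutation *)

Section Embedding.
Variables (K K' : fieldType) (T T' : finType).
Variables (phi : {rmorphism K' -> K}) (g : T' -> T) (e : T' -> bool).
Hypothesis g_inj : injective g.

Record seed_embedding (S' : preseed K' T') (S : preseed K T) : Prop := {
  emb_exch : forall x, x \in exch S' -> g x \in exch S;
  emb_cvar : forall t, phi (cvar S' t) = cvar S (g t);
  emb_sign : sign_embedding (exch S') g e (bmat S') (bmat S)
}.

(** Row [g x] vanishes off the image of [g], so no further variable enters its exchange sum; a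
    negative sign only swaps the two monomials. *)
Lemma seed_embedding_exchange S' S x : seed_embedding S' S -> x \in exch S' ->
  phi (exchange S' x) = exchange S (g x).
Proof.
move=> [_ cv [row off _]] xS; rewrite !exchangeE rmorphM fmorphV cv.
congr (_ * _); rewrite rmorph_exchange_sum.
rewrite [RHS](exchange_sum_codom _ g_inj); last by move=> s; apply: off.
case ex : (e x); last first.
  by apply: eq_exchange_sum => [t|t] /=; rewrite ?cv // row // ex mul1r.
rewrite -exchange_sumN.
by apply: eq_exchange_sum => [t|t] /=; rewrite ?cv // row // ex mulN1r.
Qed.

Lemma seed_embedding_mutate S' S x : seed_embedding S' S -> x \in exch S' ->
  seed_embedding (mutate S' x) (mutate S (g x)).
Proof.
move=> emb xS; split=> [|t|] /=; first exact: emb_exch emb.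
  rewrite (inj_eq g_inj); case: eqP => _; first exact: seed_embedding_exchange.
  exact: emb_cvar emb t.
exact: sign_embedding_mutate (emb_sign emb).
Qed.

Lemma seed_embedding_foldl S' S s : seed_embedding S' S ->
  all (fun x => x \in exch S') s ->
  seed_embedding (foldl (@mutate K' T') S' s)
                 (foldl (@mutate K T) S (map g s)).
Proof.
elim: s S' S => //= x s IHs S' S emb /andP [xS sS]; apply: IHs => //.
exact: seed_embedding_mutate.
Qed.

(** The current seeds are kept as iterated mutations of the initial ones, where the variables are
    known to be distinct. Hence the element [phi y] has the label [g x] when [y] has the label
    [x]. *)
Lemma seed_embedding_mutate_elt_seq S' S ys s a : is_seed S ->
  seed_embedding S' S -> all (fun x => x \in exch S') s ->
  admissible (foldl (@mutate K' T') S' s) ys ->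
  phi (mutate_elt_seq (foldl (@mutate K' T') S' s) ys a) =
  mutate_elt_seq (foldl (@mutate K T) S (map g s)) (map phi ys) (phi a).
Proof.
move=> S_seed emb; elim: ys s a => //= y ys IHys s a sS /andP [].
have embs := seed_embedding_foldl emb sS.
rewrite /exchangeable /mutate_at /mutate_elt.
case ly : (label_of _ y) => [x|//] _ adm.
have [xS yx] : x \in exch S' /\ cvar (foldl (@mutate K' T') S' s) x = y.
  move: ly; rewrite /label_of; case: pickP => // z /andP [zS /eqP zy] [<-].
  by rewrite -(exch_foldl S' s).
have -> : label_of (foldl (@mutate K T) S (map g s)) (phi y) = Some (g x).
  rewrite -yx (emb_cvar embs) label_of_cvar //.
    apply: (mutated_cvar_inj S_seed); rewrite all_map.
    by apply: sub_all sS => z; apply: emb_exch emb z.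
  by rewrite exch_foldl; apply: emb_exch emb x xS.
rewrite (inj_eq (fmorph_inj phi)).
rewrite -!foldl_rcons -map_rcons IHys ?all_rcons ?xS ?foldl_rcons //.
congr mutate_elt_seq; case: ifP => // _.
by apply: seed_embedding_exchange embs _; rewrite exch_foldl.
Qed.

End Embedding.

(** * From seed embeddings to rooted cluster subalgebras *)

Lemma cvar_in_cluster_alg (K : fieldType) (T : finType) (S : preseed K T) t :
  cvar S t \in cluster_alg_pred S.
Proof.
apply/asboolP => P _ hf hc; have [tS|/hf//] := boolP (t \in exch S).
exact: (hc [::] t).
Qed.

Lemma exchange_in_cluster_alg (K : fieldType) (T : finType) (S : preseed K T) x :
  x \in exch S -> exchange S x \in cluster_alg_pred S.
Proof.
move=> xS; apply/asboolP => P _ _ hc.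
have := hc [:: x] x; rewrite /= eqxx xS.
exact.
Qed.

(** The preimage under [phi] of the cluster algebra of [S] is a subring containing the generators of
    that of [S']. *)
Lemma seed_embedding_cluster_alg (K K' : fieldType) (T T' : finType)
    (phi : {rmorphism K' -> K}) (g : T' -> T) e (S' : preseed K' T')
    (S : preseed K T) a : injective g ->
  seed_embedding phi g e S' S ->
  a \in cluster_alg_pred S' -> phi a \in cluster_alg_pred S.
Proof.
move=> g_inj emb /asboolP aS'.
pose P : {pred K'} := fun z => phi z \in cluster_alg_pred S.
have PE z : (z \in P) = (phi z \in cluster_alg_pred S) by [].
rewrite -PE; apply: aS' => [|t _|s x sS xS].
- split=> [|x y|x y]; rewrite !PE.
  + by rewrite rmorph1 rpred1.
  + by move=> xS yS; rewrite rmorphB rpredB.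
  + by move=> xS yS; rewrite rmorphM rpredM.
- by rewrite PE (emb_cvar emb) cvar_in_cluster_alg.
- rewrite PE (emb_cvar (seed_embedding_foldl g_inj emb sS)).
  apply/asboolP => Q _ _; apply; last exact: emb_exch emb x xS.
  by rewrite all_map; apply: sub_all sS => z; apply: emb_exch emb z.
Qed.

Lemma seed_embedding_subalgebra (K K' : fieldType) (T T' : finType)
    (phi : {rmorphism K' -> K}) (g : T' -> T) e (S' : preseed K' T')
    (S : preseed K T) : injective g -> is_seed S ->
  seed_embedding phi g e S' S -> rooted_cluster_subalgebra S' S.
Proof.
move=> g_inj S_seed emb.
pose f (a : cluster_alg S') : cluster_alg S :=
  ClusterAlg (seed_embedding_cluster_alg g_inj emb (valP a)).
have fB : zmod_morphism f.
  by move=> x y; apply: val_inj; rewrite /= !rmorphB.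
have fM : monoid_morphism f.
  by split=> [|x y]; apply: val_inj; rewrite /= ?rmorph1 ?rmorphM.
pose F : {rmorphism cluster_alg S' -> cluster_alg S} := HB.pack f
  (GRing.isZmodMorphism.Build _ _ f fB) (GRing.isMonoidMorphism.Build _ _ f fM).
exists F; split; last first.
  by move=> x y /(congr1 val) /= /fmorph_inj /val_inj.
split=> [a [x ax]|a [x xS ax]|ys a b [adm _] _ ba].
- by left; exists (g x); rewrite /= -(emb_cvar emb) -ax.
- left; exists (g x); first exact: emb_exch emb x xS.
  by rewrite /= -(emb_cvar emb) -ax.
- have -> : val (F b) = phi (val b) by [].
  rewrite ba.
  rewrite (seed_embedding_mutate_elt_seq g_inj (s := [::]) _ S_seed emb) //.
  by rewrite -map_comp.
Qed.

(** * Recovering labels and row signs from isomorphisms and morphisms *)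

Lemma pospartE z : z = (pospart z)%:Z - (pospart (- z))%:Z.
Proof.
rewrite /pospart oppr_gt0; case: (ltrgt0P z) => [z0|z0|->]; last by [].
  by rewrite gtz0_abs // subr0.
by rewrite abszN ltz0_abs // sub0r opprK.
Qed.

(** Pushing exponents forward along [g] turns both sides into sums of two monomials in [v]. These
    match in order or crosswise, which gives the two possible signs; off the image the pushed
    exponents are 0. *)
Lemma exchange_sum_comp_eq (K : fieldType) (T T' : finType) (v : T -> K)
    (g : T' -> T) b' b : independent_over_int v -> injective g ->
  exchange_sum (v \o g) b' = exchange_sum v b ->
  (exists e : bool, forall t, b (g t) = (-1) ^+ e * b' t) /\
  (forall s, s \notin codom g -> b s = 0).
Proof.
move=> v_indep g_inj; rewrite {1}/exchange_sum !(monomial_comp v g).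
have fiber (a : T' -> nat) t : (\sum_(t' | g t' == g t) a t' = a t)%N.
  by rewrite (eq_bigl (pred1 t)) ?big_pred1_eq // => t'; rewrite /= inj_eq.
have off (a : T' -> nat) s : s \notin codom g -> (\sum_(t' | g t' == s) a t' = 0)%N.
  by move=> sg; apply: big1 => t /eqP ts; case/negP: sg; rewrite -ts codom_f.
case/(two_monomials v_indep) => - [E1 E2]; split=> [|s sg].
- exists false => t; rewrite mul1r (pospartE (b _)) (pospartE (b' _)).
  by rewrite -[pospart (- b _)]E2 -[pospart (b _)]E1 !fiber.
- rewrite (pospartE (b s)) -[pospart (- b _)]E2 -[pospart (b _)]E1.
  by rewrite !off.
- exists true => t; rewrite mulN1r (pospartE (b _)) (pospartE (b' _)).
  by rewrite -[pospart (- b _)]E1 -[pospart (b _)]E2 !fiber opprB.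
- rewrite (pospartE (b s)) -[pospart (- b _)]E1 -[pospart (b _)]E2.
  by rewrite !off.
Qed.

Lemma sqr_le0_eq0 (z : int) : z * z <= 0 -> z = 0.
Proof. by move=> z0; apply/eqP; rewrite -sqrf_eq0 eq_le sqr_ge0 expr2 z0. Qed.

(** Two pairs with the same first label are adjacent, which gives each row a single sign. The labels
    missed by [g] lie in [I1], where the rows vanish by hypothesis. *)
Lemma mixing_subseed_embedding (K K' : fieldType) (T T' : finType)
    (S : preseed K T) (S' : preseed K' T') (I0 I1 : {set T}) :
  is_seed S' -> seed_isomorphic S' (mixing_subseed S I0 I1) ->
  (forall x y, x \in exch S :\: (I0 :|: I1) -> y \in I1 -> bmat S x y = 0) ->
  exists g e, [/\ injective g, forall x, x \in exch S' -> g x \in exch S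
                & sign_embedding (exch S') g e (bmat S') (bmat S)].
Proof.
move=> S'_seed [g0 [[_ adj] exch_g0 [h hK Kh] bmat_g0]] off.
pose g t := val (g0 t).
have gP x : x \in exch S' -> g x \in exch S :\: (I0 :|: I1).
  by move=> xS; have := imset_f g0 xS; rewrite exch_g0 inE.
have {}adj x y z w : x \in exch S' -> z \in exch S' ->
    adjacent S' (x, y) (z, w) ->
    0 <= (bmat S (g x) (g y) * bmat S' x y) * (bmat S (g z) (g w) * bmat S' z w).
  by move=> xS zS xz; have [] := adj x y z w xS zS xz.
have {}bmat_g0 x y : x \in exch S' ->
    bmat S (g x) (g y) = bmat S' x y \/ bmat S (g x) (g y) = - bmat S' x y.
  move=> xS; have /eqP := bmat_g0 x y xS; rewrite eqr_norm2 /= -/(g x) -/(g y).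
  by case/orP => /eqP ->; [left | right; rewrite opprK].
(* A row is reversed as soon as one entry is; a zero row gets the positive sign. *)
pose e x := [exists y, bmat S (g x) (g y) * bmat S' x y < 0].
have row x y : x \in exch S' -> bmat S (g x) (g y) = (-1) ^+ e x * bmat S' x y.
  move=> xS; rewrite /e; case: existsP => [[w xw]|nex].
    have := adj x y x w xS xS; rewrite /adjacent eqxx orbT => /(_ isT).
    rewrite nmulr_lge0 // mulN1r.
    by case: (bmat_g0 x y xS) => -> // /sqr_le0_eq0 ->; rewrite oppr0.
  have : 0 <= bmat S (g x) (g y) * bmat S' x y.
    by rewrite leNgt; apply/negP => xy; case: nex; exists y.
  rewrite mul1r; case: (bmat_g0 x y xS) => -> //.
  by rewrite mulNr oppr_ge0 => /sqr_le0_eq0 ->; rewrite oppr0.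
exists g, e; split=> [t t' /val_inj /(can_inj hK) // | x /gP | ].
  by rewrite inE => /andP [].
split=> // [x s xS sg|x z xS zS xz0].
  apply: off (gP x xS) _; apply: contraNT sg => sI1.
  by apply/codomP; exists (h (Sub s sI1)); rewrite /g Kh SubK.
have xz_neg := sign_skew_symmetric_neq0 (seed_sss S'_seed) xS zS xz0.
have sqr_gt0 : 0 < (bmat S' x z * bmat S' z x) * (bmat S' x z * bmat S' z x).
  by rewrite nmulr_lgt0.
(* If the signs of the two rows differed, this product would be minus the square of
   [bmat S' x z * bmat S' z x]. *)
have := adj x z z x xS zS; rewrite /adjacent xz0 => /(_ isT).
rewrite !row // leNgt; case: (e x); case: (e z) => // /negP [];
  by rewrite mulN1r mul1r mulNr ?mulrN ?mulNr oppr_lt0 mulrACA.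
Qed.

(* Only one-step mutations are needed here: CM3 for the sequence [:: x] compares
   the two exchange relations at [x]. *)
Lemma rooted_cluster_morphism_labels (K K' : fieldType) (T T' : finType)
    (S : preseed K T) (S' : preseed K' T')
    (f : {rmorphism cluster_alg S' -> cluster_alg S}) :
  is_seed S -> is_seed S' -> rooted_cluster_morphism f -> injective f ->
  exists g : T' -> T, [/\ injective g,
    forall x, x \in exch S' -> g x \in exch S
    & forall x, x \in exch S' ->
      (exists e : bool, forall t,
         bmat S (g x) (g t) = (-1) ^+ e * bmat S' x t) /\
      (forall s, s \notin codom g -> bmat S (g x) s = 0)].
Proof.
move=> hS hS' [CM1 CM2 CM3] f_inj.
pose var t := ClusterAlg (cvar_in_cluster_alg S' t).
have not_int t : ~ is_integer (f (var t)).
  (* Integers are fixed by [f], so injectivity would make a variable of [S'] an integer. *)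
  move=> [k]; rewrite -(rmorph_int f) => /f_inj /(congr1 val).
  by rewrite rmorph_int => /(cvar_not_int hS').
have /choice [g gP] t : exists s, val (f (var t)) = cvar S s.
  case: (CM1 (var t)) => [|//|/not_int//].
  by exists t.
have g_inj : injective g.
  move=> t t' gt; apply: (cvar_inj hS').
  have /val_inj /f_inj /(congr1 val) // : val (f (var t)) = val (f (var t')).
  by rewrite !gP gt.
have gX x : x \in exch S' -> g x \in exch S.
  move=> xS; case: (CM2 (var x)) => [|[s sS]|/not_int//]; first by exists x.
  by rewrite gP => /(cvar_inj hS) ->.
exists g; split=> // x xS; apply: (exchange_sum_comp_eq (v := cvar S)) => //.
  exact/alg_independent_int/seed_independent.
pose z := ClusterAlg (exchange_in_cluster_alg xS).
have lab' := label_of_cvar (cvar_inj hS') xS.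
have lab := label_of_cvar (cvar_inj hS) (gX x xS).
have fz : val (f z) = exchange S (g x).
  rewrite (@CM3 [:: var x] (var x) z) /= ?gP.
  - by rewrite /mutate_elt lab eqxx.
  - by split; rewrite /= ?gP /exchangeable ?lab ?lab'.
  - by exists x.
  - by rewrite /mutate_elt lab' eqxx.
have neq0 (L : fieldType) (U : finType) (R : preseed L U) t :
    is_seed R -> cvar R t != 0.
  by move=> hR; apply/eqP => /(@cvar_not_int _ _ _ hR t 0).
(* The exchange relation in product form is an identity inside the cluster algebra, so [f] applies
   to it. *)
have E : var x * z = exchange_sum var (bmat S' x).
  apply: val_inj; rewrite rmorphM rmorph_exchange_sum /= exchangeE.
  by rewrite mulVKf ?neq0.
have := congr1 (fun a => val (f a)) E.
rewrite !rmorphM !rmorph_exchange_sum /= gP fz exchangeE mulVKf ?neq0 // => ->.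
apply: eq_exchange_sum => // t.
by rewrite /= gP.
Qed.

Theorem theorem4p4 (K K' : fieldType) (T T' : finType)
    (S : preseed K T) (S' : preseed K' T') (hS : is_seed S) (hS' : is_seed S') :
  rooted_cluster_subalgebra S' S <->
  exists I0 I1 : {set T},
    [/\ I0 \subset exch S, [disjoint I0 & I1],
        seed_isomorphic S' (mixing_subseed S I0 I1)
      & forall x y, x \in exch S :\: (I0 :|: I1) -> y \in I1 ->
          bmat S x y = 0].
Proof.
split=> [[f [f_rcm f_inj]]|[I0 [I1 [_ _ S'_iso off]]]]; last first.
  have [g [e [g_inj gX sgn]]] := mixing_subseed_embedding hS' S'_iso off.
  have [phi phiP] := field_morphism
    (alg_independent_int (seed_independent hS')) (seed_generates hS')
    (independent_comp g_inj (alg_independent_int (seed_independent hS))).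
  exact: (@seed_embedding_subalgebra _ _ _ _ phi g e).
have [g [g_inj gX gB]] := rooted_cluster_morphism_labels hS hS' f_rcm f_inj.
(* Labels missed by [g] are deleted; exchangeable labels that are images of frozen ones are
   frozen. *)
pose I1 := [set s | s \notin codom g].
pose I0 := [set s in exch S | (s \in codom g) && (s \notin g @: exch S')].
have gI1 t : g t \notin I1 by rewrite inE negbK codom_f.
have XE s : (s \in exch S :\: (I0 :|: I1)) = (s \in g @: exch S').
  rewrite !inE; apply/idP/imsetP => [|[x xS ->]]; last first.
    by rewrite codom_f gX // imset_f.
  case: (boolP (s \in g @: exch S')) => [/imsetP //|_].
  by case: (s \in exch S); case: (s \in codom g).
exists I0, I1; split; first by apply/subsetP => s; rewrite inE => /andP [].
- by rewrite disjoint_subset; apply/subsetP => s; rewrite !inE negbK => /and3P [].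
- pose g0 t : {s : T | s \notin I1} := Sub (g t) (gI1 t).
  have bmat_g0 x y :
    bmat (mixing_subseed S I0 I1) (g0 x) (g0 y) = bmat S (g x) (g y) by [].
  have row x y : x \in exch S' ->
      `|bmat S' x y| = `|bmat (mixing_subseed S I0 I1) (g0 x) (g0 y)|.
    by move=> /gB [[e exP] _]; rewrite bmat_g0 exP normrM normr_sign mul1r.
  exists g0; split=> //; first split.
  + by move=> x xS; rewrite inE (XE (g x)) imset_f.
  + move=> x y z w xS zS xz; split; last by rewrite row.
    have same_sign (e : bool) (a c : int) :
        0 <= (-1) ^+ e * a * a * ((-1) ^+ e * c * c).
      have := mulr_ge0 (sqr_ge0 a) (sqr_ge0 c); rewrite !expr2.
      by case: e; rewrite ?mulN1r ?mul1r ?mulNr ?mulrN ?opprK.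
    have [[ex exP] _] := gB x xS; have [[ez ezP] _] := gB z zS.
    rewrite !bmat_g0 exP; have [/= xz0|/eqP /= <-] := orP xz; last first.
      by rewrite exP; apply: same_sign.
    (* The opposite entries at [x] and [z] have negative product in both matrices. Passing from one
       matrix to the other multiplies this product by the signs of the two rows, so these are
       equal. *)
    rewrite ezP; suff -> : ez = ex by apply: same_sign.
    have xz_neg := sign_skew_symmetric_neq0 (seed_sss hS') xS zS xz0.
    have gxz0 : bmat S (g x) (g z) != 0 by rewrite exP mulf_neq0 ?signr_eq0.
    have := sign_skew_symmetric_neq0 (seed_sss hS) (gX x xS) (gX z zS) gxz0.
    rewrite exP ezP mulrACA; move: xz_neg.
    by case: (ex); case: (ez) => //= neg; rewrite ?expr0 ?expr1 ?mulr1 ?mul1r;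
      rewrite mulN1r oppr_lt0 ltNge ltW.
  + apply/setP => s; rewrite inE (XE (val s)); apply/imsetP/imsetP => [[x xS ->]|[x xS sx]].
      by exists x.
    by exists x => //; apply: val_inj.
  + have cod (s : {s : T | s \notin I1}) : val s \in codom g.
      by have := valP s; rewrite /= inE negbK.
    exists (fun s => iinv (cod s)) => [t|s].
      by apply: g_inj; rewrite f_iinv.
    by apply: val_inj; rewrite /= f_iinv.
- move=> x y; rewrite XE => /imsetP [x' xS ->]; rewrite inE => yg.
  by have [_] := gB x' xS; apply.
Qed.
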